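(* Let $X=\{X_t\}_{t\ge0}$ be a Markov chain with state space $S$ of size $n$ and stationary distribution $\pi$, and suppose that $\psi$ is a real-valued function on the positive integers such that $\mathbf{P}_x(\tau(y)=t)\le\psi(t)$ for all $x,y\in S$ and all integers $t>0$. Then for all $x,y\in S$ and any integers $t>s>0$, $$\mathbf{P}_x(\tau(y)=t)\le d_x(s)\,\psi(t-s)+\frac{1}{t-s}.$$ In particular, if $t>2\,t_{\mathrm{mix}}(1/4)\,\lceil\log_2 n\rceil$, then $$\mathbf{P}_x(\tau(y)=t)\le\frac4t.$$
   Context: Markov chains are in discrete time and time-homogeneous. $\mathbf{P}_x$ denotes the probability for the chain started at $X_0=x$, and $p^t(x,\cdot)$ is the distribution of $X_t$ under $\mathbf{P}_x$. The hitting time is $\tau(y)=\min\{t\ge 0: X_t=y\}$ ($\infty$ if $y$ is never reached). $d_x(t)=\|p^t(x,\cdot)-\pi\|_{\mathrm{TV}}$, where $\|\mu-\nu\|_{\mathrm{TV}}=\frac12\sum_{z\in S}|\mu(z)-\nu(z)|$ is total variation distance. The mixing time $t_{\mathrm{mix}}(\epsilon)$ is the earliest time $t\ge0$ for which $d_x(t)\le\epsilon$ for every state $x$; if there is no such time, $t_{\mathrm{mix}}(\epsilon)=\infty$ and the hypothesis of the second statement is taken never to hold. *)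

(* Defs.v *)
From mathcomp Require Export all_boot all_order all_algebra.
From mathcomp Require Export all_classical all_reals all_analysis.

Set Implicit Arguments.
Unset Strict Implicit.
Unset Printing Implicit Defensive.

Import Order.TTheory GRing.Theory Num.Theory.

Local Open Scope classical_set_scope.
Local Open Scope ring_scope.

(* None stands for infinity: A holds at no time. *)
Definition first_time (A : pred nat) : option nat :=
  if pselect (exists t, A t) is left exA then Some (ex_minn exA) else None.

Definition log2 (R : realType) (x : R) : R := ln x / ln 2.

Section Stochastic.
Variables (R : realType) (S : finType).

Record is_distribution (mu : S -> R) : Prop := IsDistribution {
  distribution_ge0 : forall z, 0 <= mu z;
  distribution_sum1 : \sum_(z : S) mu z = 1 }.

Definition is_stochastic (p : S -> S -> R) : Prop :=
  forall x, is_distribution (p x).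

Record is_stationary (p : S -> S -> R) (pi : S -> R) : Prop := IsStationary {
  stationary_distribution : is_distribution pi;
  stationary_invariant : forall y, \sum_(x : S) pi x * p x y = pi y }.

Definition dTV (mu nu : S -> R) : R := 2^-1 * \sum_(z : S) `|mu z - nu z|.

End Stochastic.

Section Chain.
Variables (R : realType) (S : finType) (d : measure_display)
  (Omega : measurableType d).

(* X is a time-homogeneous Markov chain with transition matrix p, started at x
   under P x. The Markov property
     P_x(X_{t+1} = z | X_0 = u_0, ..., X_t = u_t) = p(u_t, z)
   is multiplied by the probability of the conditioning event, so that it
   requires nothing when that event is null. *)
Record is_markov_chain (p : S -> S -> R) (P : S -> probability Omega R)
    (X : nat -> Omega -> S) : Prop := IsMarkovChain {
  chain_stochastic : is_stochastic p;
  chain_measurable : forall t z, measurable [set w | X t w = z];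
  chain_start : forall x, P x [set w | X 0%N w = x] = 1%E;
  chain_step : forall x t (u : nat -> S) z,
    P x ([set w | forall i, (i <= t)%N -> X i w = u i] `&`
         [set w | X t.+1 w = z]) =
    (P x [set w | forall i, (i <= t)%N -> X i w = u i] * (p (u t) z)%:E)%E }.

Variables (P : S -> probability Omega R) (X : nat -> Omega -> S).

Definition hitting_time (y : S) (w : Omega) : option nat :=
  first_time (fun t => X t w == y).

Definition hit_prob (x y : S) (t : nat) : R :=
  fine (P x [set w | hitting_time y w = Some t]).

Definition chain_law (t : nat) (x z : S) : R := fine (P x [set w | X t w = z]).

Variable pi : S -> R.

Definition dist_pi (x : S) (t : nat) : R := dTV (chain_law t x) pi.

Definition tmix (eps : R) : option nat :=
  first_time (fun t => [forall x, dist_pi x t <= eps]).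

End Chain.

(* Main.v *)
Require Import Defs.
From mathcomp Require Import ring zify.
Import Order.TTheory GRing.Theory Num.Theory.
Local Open Scope ring_scope.

(* Splitting at time s and comparing the law of X_s with pi,
     P_x(tau(y) = t) <= \sum_z (p^s(x,z) - pi z) P_z(tau(y) = t - s)
                        + P_pi(tau(y) = t - s);
   the first sum is at most d_x(s) psi(t - s), and P_pi(tau(y) = r) is
   nonincreasing in r with sum at most 1, so the second term is at most
   1 / (t - s).
   For the second claim take psi(r) = n / r. On {tau(y) = r} the r times before
   r are shared among the states z, so it suffices that the expected number of
   visits to z on {tau(y) = r} is at most 1. When the chain starts at z, exchange
   the pieces of the trajectory before and after a visit to z: the expectation
   becomes the probability that the chain, sent back to z whenever it would enter
   y, is at z at time r after exactly one such relocation. Finally d_x(k m) <= 2^-k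
   when d_w(m) <= 1/4 for all w. *)

(** * First passage under a stochastic matrix *)

Section Kernel.
Set Implicit Arguments.
Unset Strict Implicit.
Variables (R : realType) (S : finType) (p : S -> S -> R).

(** The [t]-th iterate sends [f] to the expectation of [f(X_t)] on the event that
    [X_0, ..., X_{t-1}] lie in [B]; the position at time [t] is left free. *)
Definition restricted_step (B : pred S) (f : S -> R) (x : S) : R :=
  if B x then \sum_w p x w * f w else 0.

Definition atom (z x : S) : R := (x == z)%:R.

Definition first_hit (y : S) (t : nat) : S -> R :=
  iter t (restricted_step (predC1 y)) (atom y).

Lemma sum_atom (f : S -> R) x : \sum_z f z * atom z x = f x.
Proof.
rewrite (bigD1 x) //= /atom eqxx mulr1 big1 ?addr0 // => z /negPf.
by rewrite eq_sym => ->; rewrite mulr0.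
Qed.

Lemma sum_atom_r (f : S -> R) z : \sum_x f x * atom z x = f z.
Proof.
rewrite -[RHS]sum_atom; apply: eq_bigr => x _; by rewrite /atom eq_sym.
Qed.

(** Linearity in [f], expanded in atoms. When [f] is itself an iterate, this is the Markov property
    at time [k]. *)
Lemma iter_restricted_stepE B k f x :
  iter k (restricted_step B) f x =
  \sum_z f z * iter k (restricted_step B) (atom z) x.
Proof.
elim: k x => [|k IHk] x; first by rewrite /= sum_atom.
under [RHS]eq_bigr do rewrite iterS {1}/restricted_step.
rewrite iterS {1}/restricted_step; case: ifP => Bx; last first.
  by rewrite big1 // => z _; rewrite mulr0.
under [LHS]eq_bigr do rewrite IHk mulr_sumr.
rewrite exchange_big /=; apply: eq_bigr => z _; rewrite mulr_sumr.
by apply: eq_bigr => w _; rewrite mulrCA.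
Qed.

Hypothesis hp : is_stochastic p.

Let p_ge0 x w : 0 <= p x w. Proof. exact: (distribution_ge0 (hp x)). Qed.
Let p_sum x : \sum_w p x w = 1. Proof. exact: (distribution_sum1 (hp x)). Qed.

Lemma restricted_step_itv B f : (forall x, 0 <= f x <= 1) ->
  forall x, 0 <= restricted_step B f x <= 1.
Proof.
move=> hf x; rewrite /restricted_step; case: ifP => _; last by rewrite lexx ler01.
apply/andP; split.
  by apply: sumr_ge0 => w _; rewrite mulr_ge0 //; case/andP: (hf w).
rewrite -(p_sum x); apply: ler_sum => w _.
by rewrite ler_piMr //; case/andP: (hf w).
Qed.

Lemma iter_restricted_step_itv B k z x :
  0 <= iter k (restricted_step B) (atom z) x <= 1.
Proof.
elim: k x => [|k IHk] x; last exact: restricted_step_itv.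
by rewrite /= /atom; case: eqP; rewrite /= ?lexx ?ler01.
Qed.

Lemma first_hit_self y t : (0 < t)%N -> first_hit y t y = 0.
Proof. by case: t => // t _; rewrite /first_hit /= /restricted_step /= eqxx. Qed.

Lemma first_hitS y t x :
  first_hit y t.+1 x = if x != y then \sum_w p x w * first_hit y t w else 0.
Proof. by []. Qed.

(** The events [tau(y) = t] are disjoint. The induction conditions on the first step: at [y] only
    [t = 0] contributes, elsewhere that term vanishes. *)
Lemma sum_first_hit_le1 y T x : \sum_(t < T) first_hit y t x <= 1.
Proof.
elim: T x => [|T IHT] x; first by rewrite big_ord0 ler01.
rewrite big_ord_recl.
under eq_bigr do rewrite lift0 first_hitS.
rewrite /first_hit /= {1}/atom; case: eqP => /= [_|_].
  by rewrite big1 // addr0.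
rewrite exchange_big /= add0r -(p_sum x).
apply: ler_sum => w _; rewrite -mulr_sumr ler_piMr //; exact: IHT.
Qed.

Lemma restricted_step_le B f x : (forall w, 0 <= f w) ->
  restricted_step B f x <= restricted_step predT f x.
Proof.
move=> f0; rewrite /restricted_step /=; case: ifP => // _.
by apply: sumr_ge0 => w _; rewrite mulr_ge0.
Qed.

Lemma iter_restricted_step_le B k z x :
  iter k (restricted_step B) (atom z) x <=
  iter k (restricted_step predT) (atom z) x.
Proof.
elim: k x => [|k IHk] x //=.
apply: le_trans (restricted_step_le _ _ _) _ => [w|].
  by case/andP: (iter_restricted_step_itv B k z w).
by apply: ler_sum => w _; rewrite ler_wpM2l.
Qed.

Lemma first_hit_ge0 y t x : 0 <= first_hit y t x.
Proof. by case/andP: (iter_restricted_step_itv (predC1 y) t y x). Qed.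

(* The left side is the probability that, at time [t], the chain on the
   complement of [y] which is sent to [z] whenever it would enter [y] is at [z]
   after at most one such relocation. *)
Lemma relocated_once_le1 y z t x : z != y ->
  \sum_(k < t) first_hit y (t - k) x *
     iter k (restricted_step (predC1 y)) (atom z) z
  + iter t (restricted_step (predC1 y)) (atom z) x <= 1.
Proof.
move=> zy; elim: t x => [|t IHt] x.
  by rewrite big_ord0 add0r; case/andP: (iter_restricted_step_itv predT 0 z x).
have [->|xy] := eqVneq x y.
  rewrite big1 => [|k _]; last by rewrite first_hit_self ?mul0r // subn_gt0.
  by rewrite add0r /= /restricted_step /= eqxx /= ler01.
set q := fun k => iter k (restricted_step (predC1 y)) (atom z).
(* First-step decomposition. The term [k = t] stands apart: the chain would enter [y] at once, is
   relocated to [z], and has [t] steps left. *)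
have -> : \sum_(k < t.+1) first_hit y (t.+1 - k) x * q k z + q t.+1 x =
    p x y * q t z +
    \sum_w p x w * (\sum_(k < t) first_hit y (t - k) w * q k z + q t w).
  rewrite big_ord_recr /= subSnn first_hitS xy sum_atom_r.
  under [in LHS]eq_bigr => k _.
    rewrite subSn ?(ltnW (ltn_ord k)) // first_hitS xy mulr_suml.
    over.
  rewrite exchange_big /= [in RHS](eq_bigr (fun w =>
    \sum_(k < t) p x w * first_hit y (t - k) w * q k z + p x w * q t w)); last first.
    by move=> w _; rewrite mulrDr mulr_sumr; under eq_bigr do rewrite mulrA.
  by rewrite big_split /= {2}/q /= /restricted_step /= xy addrA [_ + p x y * _]addrC.
(* The average has no contribution from [w = y], so the weight [p x y] is free to bound
   [p x y * q t z]. *)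
rewrite -(p_sum x) (bigD1 y) //= [leRHS](bigD1 y) //=.
have -> : \sum_(k < t) first_hit y (t - k) y * q k z + q t y = 0.
  rewrite big1 => [|k _]; last by rewrite first_hit_self ?mul0r // subn_gt0.
  rewrite add0r /q; case: t {IHt} => [|t] /=; last by rewrite /restricted_step /= eqxx.
  by rewrite /atom eq_sym (negPf zy).
rewrite mulr0 add0r lerD //.
  by rewrite ler_piMr //; case/andP: (iter_restricted_step_itv (predC1 y) t z z).
by apply: ler_sum => w _; rewrite ler_piMr //; exact: IHt.
Qed.

(** At [x = z], commuting the two factors of each term gives the sum in [relocated_once_le1]. From
    another start the term [k = 0] vanishes, and the rest is an average over the first step of the
    same sums at the preceding time. *)
Lemma expected_visits_le1 y z t x : z != y ->
  \sum_(k < t) iter k (restricted_step (predC1 y)) (atom z) x *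
    first_hit y (t - k) z <= 1.
Proof.
move=> zy; set q := fun k => iter k (restricted_step (predC1 y)) (atom z).
have [xz|xz] := eqVneq x z.
  apply: le_trans (relocated_once_le1 t z zy); rewrite xz.
  under eq_bigr do rewrite mulrC.
  by rewrite lerDl; case/andP: (iter_restricted_step_itv (predC1 y) t z z).
elim: t x xz => [|t IHt] x xz; first by rewrite big_ord0 ler01.
have IH w : \sum_(k < t) q k w * first_hit y (t - k) z <= 1.
  have [->|] := eqVneq w z; last exact: IHt.
  apply: le_trans (relocated_once_le1 t z zy).
  under eq_bigr do rewrite mulrC.
  by rewrite lerDl; case/andP: (iter_restricted_step_itv (predC1 y) t z z).
rewrite big_ord_recl [iter ord0 _ _ x]/= {1}/atom (negPf xz) mul0r add0r.
under eq_bigr do rewrite lift0 subSS iterS {1}/restricted_step.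
case: (predC1 y x); last by rewrite big1 ?ler01 // => k _; rewrite mul0r.
under eq_bigr do rewrite mulr_suml.
rewrite exchange_big /= -(p_sum x); apply: ler_sum => w _.
under eq_bigr do rewrite -mulrA.
by rewrite -mulr_sumr ler_piMr //; exact: IH.
Qed.

Lemma first_hit_le_card y t x : (0 < t)%N -> first_hit y t x <= #|S|%:R / t%:R.
Proof.
move=> t0; rewrite ler_pdivlMr ?ltr0n //.
(* Every [k < t] contributes one copy of [first_hit y t x], split by the position [z] at time
   [k]. *)
have -> : first_hit y t x * t%:R = \sum_z \sum_(k < t)
    iter k (restricted_step (predC1 y)) (atom z) x * first_hit y (t - k) z.
  rewrite exchange_big /= mulr_natr -[X in _ *+ X](card_ord t) -sumr_const.
  apply: eq_bigr => k _; under eq_bigr do rewrite mulrC.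
  by rewrite -iter_restricted_stepE /first_hit -iterD subnKC // ltnW.
rewrite -sum1_card natr_sum; apply: ler_sum => z _.
have [->|zy] := eqVneq z y; last exact: expected_visits_le1.
by rewrite big1 ?ler01 // => k _; rewrite first_hit_self ?mulr0 // subn_gt0.
Qed.

(** * Laws of the chain and the stationary distribution *)

Definition law (t : nat) (x z : S) : R :=
  iter t (restricted_step predT) (atom z) x.

Lemma iter_stepE k f x :
  iter k (restricted_step predT) f x = \sum_z law k x z * f z.
Proof. by rewrite iter_restricted_stepE; apply: eq_bigr => z _; rewrite mulrC. Qed.

Lemma lawD s t x z : law (s + t) x z = \sum_w law s x w * law t w z.
Proof. by rewrite /law iterD iter_stepE. Qed.

Lemma law_distribution t x : is_distribution (law t x).
Proof.
split=> [z|]; first by case/andP: (iter_restricted_step_itv predT t z x).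
under eq_bigr do rewrite -[law _ _ _]mulr1.
rewrite -(iter_stepE t (fun=> 1)).
elim: t x => //= t IHt x; rewrite /restricted_step /=.
by under eq_bigr do rewrite IHt mulr1.
Qed.

(** The Markov property at time [s], with the condition of avoiding [y] before [s] dropped. *)
Lemma first_hitD_le y s t x :
  first_hit y (s + t) x <= \sum_z law s x z * first_hit y t z.
Proof.
rewrite /first_hit iterD iter_restricted_stepE; apply: ler_sum => z _.
rewrite mulrC ler_wpM2r ?iter_restricted_step_le //.
exact: first_hit_ge0.
Qed.

Variable pi : S -> R.
Hypothesis hpi : is_stationary p pi.

Let pi_ge0 x : 0 <= pi x.
Proof. exact: (distribution_ge0 (stationary_distribution hpi)). Qed.
Let pi_sum : \sum_x pi x = 1.
Proof. exact: (distribution_sum1 (stationary_distribution hpi)). Qed.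

Lemma stationary_law t z : \sum_x pi x * law t x z = pi z.
Proof.
rewrite /law; elim: t => [|t IHt]; first by rewrite sum_atom_r.
rewrite /= /restricted_step /=; under eq_bigr do rewrite mulr_sumr.
rewrite exchange_big /= -[RHS]IHt; apply: eq_bigr => w _.
under eq_bigr do rewrite mulrA.
by rewrite -mulr_suml (stationary_invariant hpi).
Qed.

(** By invariance the right side is the probability under [P_pi] that the first visit to [y] at a
    positive time occurs at [t+1]; the left side also asks that [X_0] differ from [y]. *)
Lemma stationary_first_hitS y t :
  \sum_x pi x * first_hit y t.+1 x <= \sum_x pi x * first_hit y t x.
Proof.
rewrite [leRHS](eq_bigr (fun w => \sum_x (pi x * p x w) * first_hit y t w)); last first.
  by move=> w _; rewrite -mulr_suml (stationary_invariant hpi).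
rewrite exchange_big; apply: ler_sum => x _; rewrite first_hitS.
case: ifP => _.
  rewrite mulr_sumr le_eqVlt; apply/orP; left; apply/eqP.
  by apply: eq_bigr => w _; rewrite mulrA.
by rewrite mulr0; apply: sumr_ge0 => w _; rewrite !mulr_ge0 ?first_hit_ge0.
Qed.

Lemma stationary_first_hit_le y t :
  (0 < t)%N -> \sum_x pi x * first_hit y t x <= 1 / t%:R.
Proof.
move=> t0; rewrite ler_pdivlMr ?ltr0n //.
have anti (i : 'I_t) :
    \sum_x pi x * first_hit y t x <= \sum_x pi x * first_hit y i x.
  rewrite -{1}(subnKC (ltnW (ltn_ord i))); elim: (t - i)%N => [|k IHk].
    by rewrite addn0.
  by rewrite addnS (le_trans (stationary_first_hitS _ _)).
rewrite mulr_natr -[X in _ *+ X](card_ord t) -sumr_const.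
apply: le_trans (_ : \sum_(i < t) \sum_x pi x * first_hit y i x <= _).
  by apply: ler_sum => i _; exact: anti.
rewrite exchange_big /= -pi_sum; apply: ler_sum => x _.
by rewrite -mulr_sumr ler_piMr // sum_first_hit_le1.
Qed.

(** * Total variation estimates *)

Lemma sum_distribution_diff_le (mu nu f : S -> R) (c : R) :
    is_distribution mu -> is_distribution nu -> (forall z, 0 <= f z <= c) ->
  \sum_z (mu z - nu z) * f z <= dTV mu nu * c.
Proof.
move=> hmu hnu hf.
(* The masses are equal, so adding the zero sum of [mu z - nu z] turns absolute values into twice
   the positive parts; these dominate term by term. *)
have -> : dTV mu nu * c = \sum_z 2^-1 * (`|mu z - nu z| + (mu z - nu z)) * c.
  rewrite -mulr_suml -mulr_sumr big_split /= sumrB.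
  by rewrite (distribution_sum1 hmu) (distribution_sum1 hnu) subrr addr0.
apply: ler_sum => z _; case/andP: (hf z) => f0 fc.
have [a0|a0] := lerP 0 (mu z - nu z).
  by rewrite ger0_norm // -mulr2n -[(_ - _) *+ 2]mulr_natl mulKf ?pnatr_eq0 // ler_wpM2l.
by rewrite ltr0_norm // addNr mulr0 mul0r nmulr_rle0.
Qed.

Lemma first_hit_le y s t x (c : R) : (s < t)%N ->
    (forall z, first_hit y (t - s) z <= c) ->
  first_hit y t x <= dTV (law s x) pi * c + 1 / (t - s)%:R.
Proof.
move=> st hc; rewrite -{1}(subnKC (ltnW st)).
apply: le_trans (first_hitD_le _ _ _ _) _.
rewrite (eq_bigr (fun z => (law s x z - pi z) * first_hit y (t - s) z +
  pi z * first_hit y (t - s) z)); last by move=> z _; rewrite -mulrDl subrK.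
rewrite big_split lerD ?stationary_first_hit_le ?subn_gt0 //.
apply: sum_distribution_diff_le => [||z].
- exact: law_distribution.
- exact: stationary_distribution hpi.
- by rewrite first_hit_ge0 hc.
Qed.

(* A signed measure [a] of total mass zero satisfies
   [(a p^m) z = \sum_w a w * (p^m w z - pi z)]. *)
Lemma dTV_lawD_le s m x (c : R) : (forall w, dTV (law m w) pi <= c) ->
  dTV (law (s + m) x) pi <= 2 * c * dTV (law s x) pi.
Proof.
move=> hc; rewrite /dTV mulrCA ler_pM2l ?invr_gt0 ?ltr0n // mulr_sumr.
have E z : law (s + m) x z - pi z =
    \sum_w (law s x w - pi w) * (law m w z - pi z).
  under eq_bigr do rewrite mulrBr mulrBl.
  rewrite !sumrB -lawD stationary_law -mulr_suml sumrB.
  by rewrite pi_sum (distribution_sum1 (law_distribution s x)) subrr mul0r subr0.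
apply: le_trans (_ : \sum_z \sum_w
    `|law s x w - pi w| * `|law m w z - pi z| <= _).
  apply: ler_sum => z _; rewrite E; apply: le_trans (ler_norm_sum _ _ _) _.
  by under eq_bigr do rewrite normrM.
rewrite exchange_big /=; apply: ler_sum => w _.
rewrite -mulr_sumr mulrC ler_wpM2r //.
by rewrite -ler_pdivrMl ?ltr0n //; exact: hc.
Qed.

(** With [c = 1/4] the factor [2 * c] of [dTV_lawD_le] is [1/2], gained once per block of [m]
    steps. *)
Lemma dTV_law_muln_le m k x : (forall w, dTV (law m w) pi <= 1 / 4) ->
  dTV (law (k * m) x) pi <= (2 ^+ k)^-1.
Proof.
move=> hm; elim: k => [|k IHk].
  rewrite expr0 invr1 /dTV ler_pdivrMl ?ltr0n // mulr1.
  apply: le_trans (_ : \sum_z (law 0 x z + pi z) <= _); last first.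
    by rewrite big_split /= pi_sum (distribution_sum1 (law_distribution 0 x)).
  apply: ler_sum => z _; apply: le_trans (ler_normB _ _) _.
  by rewrite !ger0_norm // (distribution_ge0 (law_distribution 0 x)).
rewrite mulSn addnC; apply: le_trans (dTV_lawD_le _ _ hm) _.
have -> : 2 * (1 / 4) = 2^-1 :> R by field.
by rewrite exprS invfM ler_pM2l ?invr_gt0 ?ltr0n.
Qed.

End Kernel.

(** * First times and finite-valued random variables *)

Lemma first_timeE (A : pred nat) t :
  first_time A = Some t <-> A t /\ forall i, (i < t)%N -> ~~ A i.
Proof.
rewrite /first_time; case: pselect => [exA|nA]; last first.
  by split=> // -[At _]; case: nA; exists t.
case: ex_minnP => m Am minm; split=> [[<-]|[At tmin]].
  by split=> // i; rewrite ltnNge; apply: contra; exact: minm.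
congr Some; apply/eqP; rewrite eqn_leq minm //= leqNgt.
by apply/negP => /tmin; rewrite Am.
Qed.

Lemma fine_probability_finite_valued d (T : measurableType d) (R : realType)
    (mu : probability T R) (I : finType) (Y : T -> I) (A : pred I) :
    (forall i, measurable [set w | Y w = i]%classic) ->
  fine (mu [set w | A (Y w)]%classic) = \sum_(i | A i) fine (mu [set w | Y w = i]%classic).
Proof.
move=> mY; have -> : ([set w | A (Y w)] = \bigcup_(i in [set` A]) [set w | Y w = i])%classic.
  by apply/seteqP; split=> [w Aw|w [i Ai Yw]]; [exists (Y w) | rewrite /= Yw].
rewrite measure_fin_bigcup //; last first.
  by move=> i j _ _ [w [/= -> ->]].
rewrite -(@bigfs _ _ _ _ (index_enum I)) ?index_enum_uniq //; last first.
  by move=> i _; rewrite mem_index_enum.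
rewrite sum_fine // => i _; exact: fin_num_measure.
Qed.

(** * From the probability space to the transition matrix *)

Section Chain.
Set Implicit Arguments.
Unset Strict Implicit.
Local Open Scope classical_set_scope.
Variables (R : realType) (S : finType) (d : measure_display)
  (Omega : measurableType d) (p : S -> S -> R) (P : S -> probability Omega R)
  (X : nat -> Omega -> S).
Hypothesis hX : is_markov_chain p P X.

(** A path is a point of a finite type, so that probabilities of path events are finite sums. *)
Definition trajectory (t : nat) (w : Omega) : {ffun 'I_t.+1 -> S} :=
  [ffun i : 'I_t.+1 => X i w].

(** Time [t] is constrained to [B] too, unlike in the iterates of [restricted_step]. *)
Definition confined_law (B : pred S) (t : nat) (x v : S) : R :=
  fine (P x [set w | [forall i, B (trajectory t w i)] && (X t w == v)]).

Lemma trajectoryE t w u :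
  trajectory t w = u <-> forall i : 'I_t.+1, X i w = u i.
Proof.
split=> [<- i|Xu]; first by rewrite ffunE.
by apply/ffunP => i; rewrite ffunE.
Qed.

Lemma measurable_trajectory t u : measurable [set w | trajectory t w = u].
Proof.
have -> : [set w | trajectory t w = u] =
    \bigcap_(i in [set: 'I_t.+1]) [set w | X i w = u i].
  by apply/seteqP; split=> w; [move/trajectoryE => + i _; exact
    | move=> Xu; apply/trajectoryE => i; exact: Xu].
apply: fin_bigcap_measurable => // i _; exact: (chain_measurable hX).
Qed.

Lemma measurable_trajectory_next t (u : {ffun 'I_t.+1 -> S} * S) :
  measurable [set w | (trajectory t w, X t.+1 w) = u].
Proof.
case: u => u v; have -> : [set w | (trajectory t w, X t.+1 w) = (u, v)] =
    [set w | trajectory t w = u] `&` [set w | X t.+1 w = v].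
  by apply/seteqP; split=> w /= [-> ->].
apply: measurableI; [exact: measurable_trajectory|exact: (chain_measurable hX)].
Qed.

Lemma trajectory_step x t u z :
  fine (P x [set w | (trajectory t w, X t.+1 w) = (u, z)]) =
  fine (P x [set w | trajectory t w = u]) * p (u ord_max) z.
Proof.
(* [chain_step] takes a path on all of [nat]; [inord] extends [u], with a default value beyond [t]
   that leaves the event unchanged. *)
have E : [set w | trajectory t w = u] =
    [set w | forall i, (i <= t)%N -> X i w = u (inord i)].
  apply/seteqP; split=> w /=; rewrite trajectoryE => Xu.
    by move=> i it; rewrite -Xu inordK.
  by move=> i; rewrite Xu ?inord_val // -ltnS.
have -> : [set w | (trajectory t w, X t.+1 w) = (u, z)] =
    [set w | trajectory t w = u] `&` [set w | X t.+1 w = z].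
  by apply/seteqP; split=> w /= [-> ->].
rewrite E (chain_step hX x t (fun i => u (inord i)) z) -E fineM //.
  by congr (_ * p (u _) z); apply: val_inj; rewrite /= inordK.
by apply: fin_num_measure; exact: measurable_trajectory.
Qed.

Lemma confined_step B x t z :
  fine (P x [set w | [forall i, B (trajectory t w i)] && (X t.+1 w == z)]) =
  \sum_v confined_law B t x v * p v z.
Proof.
rewrite (fine_probability_finite_valued (P x)
  (fun u : {ffun 'I_t.+1 -> S} * S => [forall i, B (u.1 i)] && (u.2 == z))
  (@measurable_trajectory_next t)).
transitivity (\sum_(u : {ffun 'I_t.+1 -> S} | [forall i, B (u i)])
    \sum_(v | v == z) fine (P x [set w | (trajectory t w, X t.+1 w) = (u, v)])).
  by rewrite pair_big; apply: eq_bigr => -[].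
under eq_bigr do rewrite big_pred1_eq trajectory_step.
(* Paths are grouped by their endpoint, the only part of them that the transition sees. *)
rewrite (partition_big (fun u : {ffun 'I_t.+1 -> S} => u ord_max) predT) //=.
apply: eq_bigr => v _; rewrite /confined_law.
have -> : [set w | [forall i, B (trajectory t w i)] && (X t w == v)] =
    [set w | [forall i, B (trajectory t w i)] && (trajectory t w ord_max == v)].
  by apply/seteqP; split=> w /=; rewrite [trajectory t w ord_max]ffunE.
rewrite (fine_probability_finite_valued (P x)
  (fun u : {ffun 'I_t.+1 -> S} => [forall i, B (u i)] && (u ord_max == v))
  (@measurable_trajectory t)) mulr_suml.
by apply: eq_bigr => u /andP[_ /eqP ->].
Qed.

Lemma confined_law0 B x v :
  confined_law B 0 x v = if B v then atom R v x else 0.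
Proof.
have X0 z : fine (P x [set w | X 0%N w = z]) = atom R z x.
  (* The masses of [X_0] sum to one and [x] has mass one, so the other masses, being nonnegative,
     vanish. *)
  have := fine_probability_finite_valued (P x) predT (chain_measurable hX 0).
  rewrite (_ : [set w | _] = setT) ?probability_setT; last exact/seteqP.
  rewrite (bigD1 x) //= (chain_start hX) /= => /esym/eqP.
  rewrite addrC -subr_eq0 addrK => /eqP s0.
  rewrite /atom; case: eqP => [<-|/eqP xz]; first by rewrite (chain_start hX).
  move: s0 => /psumr_eq0P s0; rewrite s0 //; last by rewrite eq_sym.
  by move=> u _; rewrite fine_ge0.
rewrite -X0 /confined_law; case: ifP => Bv.
  congr (fine (P x _)); apply/seteqP; split=> w /=; first by case/andP => _ /eqP.
  move=> Xv; rewrite Xv eqxx andbT; apply/forallP => i.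
  by rewrite ffunE ord1 Xv.
rewrite (_ : [set w | _] = set0) ?measure0 //; apply/seteqP; split=> // w /=.
by move=> /andP[/forallP /(_ ord0)]; rewrite ffunE => + /eqP Xv; rewrite Xv Bv.
Qed.

Lemma confined_lawS B x t z : confined_law B t.+1 x z =
  if B z then \sum_v confined_law B t x v * p v z else 0.
Proof.
rewrite -confined_step /confined_law; case: ifP => Bz; last first.
  rewrite (_ : [set w | _] = set0) ?measure0 //; apply/seteqP; split=> // w /=.
  move=> /andP[/forallP /(_ ord_max)]; rewrite ffunE => + /eqP Xv.
  by rewrite /= Xv Bz.
congr (fine (P x _)); apply/seteqP; split=> w /= /andP[/forallP Bw /eqP Xz];
  rewrite Xz eqxx andbT; apply/forallP => i; rewrite ffunE.
- by have := Bw (widen_ord (leqnSn _) i); rewrite ffunE.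
- have [it|] := ltnP i t.+1; first by have := Bw (Ordinal it); rewrite ffunE.
  rewrite leq_eqVlt ltnNge -ltnS ltn_ord orbF => /eqP <-.
  by rewrite Xz.
Qed.

(** Duality between the law evolving forward and functions evolving backward. Cutting [f] off
    outside [B] accounts for the constraint at time [t]. *)
Lemma sum_confined_law B x t (f : S -> R) :
  \sum_v confined_law B t x v * f v =
  iter t (restricted_step p B) (fun v => if B v then f v else 0) x.
Proof.
elim: t f => [|t IHt] f.
  under eq_bigr do rewrite confined_law0.
  rewrite /= -[RHS](sum_atom (fun v => if B v then f v else 0)).
  by apply: eq_bigr => v _; case: (B v); rewrite ?mul0r // mulrC.
rewrite iterSr.
have -> : restricted_step p B (fun v => if B v then f v else 0) =
    fun v => if B v then \sum_z p v z * (if B z then f z else 0) else 0 by [].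
rewrite -IHt; under [LHS]eq_bigr do rewrite confined_lawS.
under [RHS]eq_bigr do rewrite mulr_sumr.
rewrite exchange_big /=; apply: eq_bigr => z _; case: (B z).
  by rewrite mulr_suml; apply: eq_bigr => v _; rewrite mulrA.
by rewrite mul0r big1 // => v _; rewrite !mulr0.
Qed.

Lemma chain_lawE t x z : chain_law P X t x z = law p t x z.
Proof.
rewrite /law -(sum_confined_law predT) sum_atom_r.
congr (fine (P x _)); apply/seteqP; split=> w /=; last by case/andP => _ /eqP.
by move=> ->; rewrite eqxx andbT; apply/forallP.
Qed.

Lemma dist_piE pi x t : dist_pi P X pi x t = dTV (law p t x) pi.
Proof. by congr (_ * _); apply: eq_bigr => z _; rewrite chain_lawE. Qed.

Lemma hit_probE x y t : (0 < t)%N -> hit_prob P X x y t = first_hit p y t x.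
Proof.
case: t => // t _; rewrite /first_hit iterSr.
(* The last step, into [y], is split off; the positions up to the time before it are confined to the
   complement of [y]. *)
have -> : restricted_step p (predC1 y) (atom R y) =
    fun v => if predC1 y v then p v y else 0.
  by apply/funext => v; rewrite /restricted_step sum_atom_r.
rewrite -sum_confined_law -confined_step.
congr (fine (P x _)); apply/seteqP; split=> w /=; rewrite /hitting_time.
  move=> /first_timeE[-> Xy]; rewrite andbT; apply/forallP => i.
  by rewrite ffunE Xy.
move=> /andP[/forallP Xy Xt]; apply/first_timeE; split=> // i it.
by have := Xy (Ordinal it); rewrite ffunE.
Qed.

End Chain.

(** * The logarithm and the two bounds *)

Lemma le_expn_log2 (R : realType) (x : R) (k : nat) :
  0 < x -> log2 x <= k%:R -> x <= 2 ^+ k.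
Proof.
move=> x0; rewrite /log2 ler_pdivrMr ?ln_gt0 ?ltr1n // mulr_natl -lnXn //.
by rewrite ler_ln ?posrE ?exprn_gt0.
Qed.

Theorem proposition1p8 (R : realType) (S : finType) (n : nat) (hn : #|S| = n)
    (d : measure_display) (Omega : measurableType d)
    (p : S -> S -> R) (P : S -> probability Omega R) (X : nat -> Omega -> S)
    (hX : is_markov_chain p P X)
    (pi : S -> R) (hpi : is_stationary p pi)
    (psi : nat -> R)
    (hpsi : forall (x y : S) (t : nat), (0 < t)%N ->
       hit_prob P X x y t <= psi t) :
  (forall (x y : S) (s t : nat), (0 < s)%N -> (s < t)%N ->
     hit_prob P X x y t <=
       dist_pi P X pi x s * psi (t - s)%N + 1 / (t - s)%:R) /\
  (forall (x y : S) (t m : nat), tmix P X pi (1 / 4) = Some m ->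
     2 * m%:Z * Num.ceil (log2 (n%:R : R)) < t%:Z ->
     hit_prob P X x y t <= 4 / t%:R).
Proof.
have hp := chain_stochastic hX.
split=> [x y s t _ st|x y t m /first_timeE[/forallP hm _]].
  rewrite (hit_probE hX) ?(leq_ltn_trans _ st) // (dist_piE hX).
  apply: (first_hit_le hp hpi) => // z.
  by rewrite -(hit_probE hX) ?subn_gt0 // hpsi // subn_gt0.
have n_gt0 : (0 < n)%N by rewrite -hn; apply/card_gt0P; exists x.
have log_ge0 : 0 <= log2 (n%:R : R).
  by rewrite /log2 divr_ge0 ?ln_ge0 ?ler1n.
have := ceil_ge (log2 (n%:R : R)).
have : 0 <= Num.ceil (log2 (n%:R : R)) by rewrite ceil_ge0 (lt_le_trans _ log_ge0).
case: (Num.ceil _) => // k _ log_le; rewrite -!PoszM ltz_nat => tk.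
(* At this time the distance is at most [2 ^- k <= 1 / n], which cancels the [n] of
   [psi(r) = n / r]: both terms of the bound are then at most [1 / (t - s)]. *)
set s := (k * m)%N.
have t_gt0 : (0 < t)%N by apply: leq_ltn_trans tk.
have s2t : (2 * s < t)%N by rewrite mulnA mulnAC.
have st : (s < t)%N by lia.
have r_gt0 : 0 < (t - s)%:R :> R by rewrite ltr0n subn_gt0.
have d_le w : dTV (law p m w) pi <= 1 / 4 by rewrite -(dist_piE hX).
have ds : dTV (law p s x) pi <= n%:R^-1.
  apply: le_trans (dTV_law_muln_le hp hpi k x d_le) _.
  by rewrite lef_pV2 ?posrE ?exprn_gt0 ?ltr0n // le_expn_log2 // ltr0n.
rewrite (hit_probE hX) //.
(* The lemma also covers [s = 0], which occurs when [n = 1] or [m = 0]. *)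
apply: le_trans (first_hit_le hp hpi x st (c := n%:R / (t - s)%:R) _) _.
  by move=> z; rewrite -hn first_hit_le_card // subn_gt0.
apply: le_trans (_ : 2 / (t - s)%:R <= _).
  have -> : 2 / (t - s)%:R = n%:R^-1 * (n%:R / (t - s)%:R) + 1 / (t - s)%:R :> R.
    by rewrite mulKf ?pnatr_eq0 -?lt0n // mul1r mulr_natl.
  by rewrite lerD2r ler_wpM2r // divr_ge0 // ltW.
(* Since [2 * s < t], one has [t <= 2 * (t - s)]. *)
rewrite ler_pdivrMr // mulrAC ler_pdivlMr ?ltr0n // -!natrM ler_nat.
lia.
Qed.
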